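(* Let $\mathbb{B}=\{0,1\}$ and, for every odd $k\ge 1$, let $M_k:\mathbb{B}^k\to\mathbb{B}$ be the $k$-input majority function, $M_k(x_1,\dots,x_k)=1$ if and only if at least $\lceil k/2\rceil$ of the $x_i$ equal $1$ (so $M_1(x)=x$). Let $\neg$ denote Boolean complementation. Fix an odd integer $n\ge 3$. Then each of the following identities holds for all values in $\mathbb{B}$ of the variables occurring in it: <ol> <li>(Commutativity) For all $1\le i<j\le n$: $M_n(x_1,\dots,x_{i-1},x_i,x_{i+1},\dots,x_{j-1},x_j,x_{j+1},\dots,x_n)=M_n(x_1,\dots,x_{i-1},x_j,x_{i+1},\dots,x_{j-1},x_i,x_{j+1},\dots,x_n)$.</li> <li>(Majority) If at least $\lceil n/2\rceil$ of the entries of $(x_1,\dots,x_n)$ are equal to $y$, then $M_n(x_1,\dots,x_n)=y$. If $x_i\neq x_j$ for some $i\neq j$ (i.e. $x_j=\neg x_i$), then $M_n(x_1,\dots,x_n)=M_{n-2}(y_1,\dots,y_{n-2})$, where $(y_1,\dots,y_{n-2})$ is obtained from $(x_1,\dots,x_n)$ by removing the entries $x_i$ and $x_j$.</li> <li>(Associativity) $M_n(z_1,\dots,z_{n-2},y,M_n(z_1,\dots,z_{n-2},x,w))=M_n(z_1,\dots,z_{n-2},x,M_n(z_1,\dots,z_{n-2},y,w))$.</li> <li>(Distributivity) For every integer $k$ with $\lceil n/2\rceil\le k\le n-1$: $M_n(x_1,\dots,x_{n-1},M_n(y_1,\dots,y_n))=M_n\big(M_n(x_1,\dots,x_{n-1},y_1),\dots,M_n(x_1,\dots,x_{n-1},y_k),y_{k+1},\dots,y_n\big)$.</li>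 <li>(Inverter propagation) $\neg M_n(x_1,\dots,x_n)=M_n(\neg x_1,\dots,\neg x_n)$.</li> </ol>
   Context: The algebraic structure considered is $(\mathbb{B},M_n,\neg,0,1)$, where ''$M_n$'' is understood to include every $M_i$ with $i\le n$ odd. The five identities above are called the axiom set $\Omega_n$; the theorem asserts that each axiom of $\Omega_n$ is sound (valid) in $(\mathbb{B},M_n,\neg,0,1)$. *)

(* Defs.v *)
From mathcomp Require Import all_boot all_fingroup.

Set Implicit Arguments.
Unset Strict Implicit.
Unset Printing Implicit Defensive.

(* uphalf k is the ceiling of k/2. *)
Definition M (k : nat) (x : k.-tuple bool) : bool :=
  uphalf k <= count_mem true x.

Lemma snoc_proof (T : Type) (n : nat) (hn : 2 < n) (x : (n - 1).-tuple T) (a : T) :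
  size (rcons x a) == n.
Proof. by rewrite size_rcons size_tuple subn1 prednK // (ltn_trans _ hn). Qed.

(* (x_1, ..., x_{n-1}, a) *)
Definition snoc (T : Type) (n : nat) (hn : 2 < n) (x : (n - 1).-tuple T) (a : T) :
  n.-tuple T := Tuple (snoc_proof hn x a).

Lemma snoc2_proof (T : Type) (n : nat) (hn : 2 < n) (z : (n - 2).-tuple T) (a b : T) :
  size (z ++ [:: a; b]) == n.
Proof. by rewrite size_cat size_tuple /= subnK // ltnW. Qed.

(* (z_1, ..., z_{n-2}, a, b) *)
Definition snoc2 (T : Type) (n : nat) (hn : 2 < n) (z : (n - 2).-tuple T) (a b : T) :
  n.-tuple T := Tuple (snoc2_proof hn z a b).

Lemma remove2_proof (T : Type) (n : nat) (x : n.-tuple T) (i j : 'I_n) (ij : i != j) :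
  size [seq tnth x l | l <- enum 'I_n & (l != i) && (l != j)] == n - 2.
Proof.
have c2 : count (mem [:: i; j]) (enum 'I_n) = 2.
  rewrite -size_filter -[RHS]/(size [:: i; j]); apply/perm_size/uniq_perm.
  - by rewrite filter_uniq // enum_uniq.
  - by rewrite /= inE ij.
  - by move=> l; rewrite mem_filter mem_enum andbT.
have := count_predC (mem [:: i; j]) (enum 'I_n).
rewrite c2 -cardE card_ord size_map size_filter.
move/(congr1 (subn^~ 2)); rewrite addKn => <-.
by apply/eqP/eq_count => l /=; rewrite !inE negb_or.
Qed.

(* x with its entries at the two distinct positions i and j removed, the order
   of the other entries being kept. *)
Definition remove2 (T : Type) (n : nat) (x : n.-tuple T) (i j : 'I_n) (ij : i != j) :
  (n - 2).-tuple T := Tuple (remove2_proof x ij).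

(* Main.v *)
Require Import Defs.
From mathcomp Require Import all_boot all_fingroup.
From mathcomp Require Import zify.

(** Writing [n = 2m + 1], the value of [M_n] depends only on the number of ones,
    compared with the threshold [m + 1].  Hence, for [x] of length [n - 1], the
    map [b |-> M_n(x, b)] is constant unless [x] has exactly [m] ones, in which
    case it is the identity.  Distributivity is immediate in the latter case; in
    the constant cases the first [k >= m + 1] entries on the right-hand side
    already form a majority. *)

(** As a sum over indices, the number of ones can be reindexed by a permutation or have single terms
    split off. *)
Lemma count_mem_true_sum (n : nat) (x : n.-tuple bool) :
  count_mem true x = \sum_(l < n) tnth x l.
Proof.
rewrite -sum1_count big_mkcond big_tuple.
by apply: eq_bigr => l _; case: (tnth x l).
Qed.

Lemma count_mem_false (s : seq bool) :
  count_mem false s = size s - count_mem true s.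
Proof.
rewrite -(count_predC (pred1 true)) addKn.
by apply: eq_count => -[].
Qed.

Lemma uphalf_odd (n : nat) : odd n -> uphalf n = n./2.+1.
Proof. by move=> odd_n; rewrite uphalf_half odd_n. Qed.

(** Oddness matters for [y = false]: at least m + 1 zeros among 2m + 1 entries leave at most m
    ones. *)
Lemma majority_le (n : nat) (x : n.-tuple bool) (y : bool) :
  odd n -> uphalf n <= count_mem y x -> M x = y.
Proof.
move=> odd_n; rewrite /M; case: y => [-> //|].
rewrite count_mem_false size_tuple uphalf_odd //.
by have := odd_double_half n; rewrite odd_n; lia.
Qed.

Lemma majority_perm (n : nat) (x : n.-tuple bool) (s : {perm 'I_n}) :
  M [tuple tnth x (s l) | l < n] = M x.
Proof.
rewrite /M !count_mem_true_sum [in RHS](reindex_inj (@perm_inj _ s)).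
by congr (_ <= _); apply: eq_bigr => l _; rewrite tnth_mktuple.
Qed.

(** Exactly one of the two removed entries is 1, so the number of ones and the threshold both drop
    by one. *)
Lemma majority_remove2 (n : nat) (x : n.-tuple bool) (i j : 'I_n) (ij : i != j) :
  1 < n -> tnth x i != tnth x j -> M x = M (remove2 x ij).
Proof.
move=> n_gt1 xij; rewrite /M count_mem_true_sum.
rewrite (bigD1 i) //= (bigD1 j) /=; last by rewrite eq_sym.
have -> : count_mem true [seq tnth x l | l <- enum 'I_n & (l != i) && (l != j)]
    = \sum_(l < n | (l != i) && (l != j)) tnth x l.
  rewrite -sum1_count big_mkcond big_map big_filter big_enum_cond /=.
  by apply: eq_bigr => l _; case: (tnth x l).
have -> : uphalf n = (uphalf (n - 2)).+1
  by rewrite -{1}(subnK n_gt1) addn2.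
by move: xij; case: (tnth x i); case: (tnth x j); rewrite ?add0n ?addn0 ?add1n.
Qed.

Lemma majority_assoc (n : nat) (hn : 2 < n) (z : (n - 2).-tuple bool) (x y w : bool) :
  M (snoc2 hn z y (M (snoc2 hn z x w))) = M (snoc2 hn z x (M (snoc2 hn z y w))).
Proof.
rewrite /M /= !count_cat /= !addn0.
(* If [x = y] the sides coincide; otherwise both are 1 exactly when [z] has at least [uphalf n - 1]
   ones, whatever [w] is. *)
by case: x y w => [] [] []; lia.
Qed.

Lemma sum_ord_ltn (n k : nat) : k <= n -> \sum_(l < n) (l < k) = k.
Proof.
move=> le_kn; rewrite -[RHS]card_ord -sum1_card.
rewrite (big_ord_widen n (fun=> 1)) // [in RHS]big_mkcond.
by apply: eq_bigr => l _; case: (l < k).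
Qed.

Lemma majority_prefix (n k : nat) (b : bool) (y : n.-tuple bool) :
  odd n -> uphalf n <= k <= n ->
  M [tuple if l < k then b else tnth y l | l < n] = b.
Proof.
move=> odd_n /andP[le_k le_kn]; apply: majority_le => //.
(* Writing [k] as a sum of indicators of [l < k] allows a termwise comparison with the count of
   [b]. *)
apply: leq_trans le_k _; rewrite -[k in k <= _](@sum_ord_ltn n) //.
rewrite -sum1_count [leqRHS]big_mkcond big_tuple; apply: leq_sum => l _.
by rewrite tnth_mktuple; case: (l < k) => //=; rewrite eqxx.
Qed.

Lemma majority_snoc (n : nat) (hn : 2 < n) (x : (n - 1).-tuple bool) :
  (exists c, forall b, M (snoc hn x b) = c) \/ (forall b, M (snoc hn x b) = b).
Proof.
have cnt b : M (snoc hn x b) = (uphalf n <= count_mem true x + b).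
  by rewrite /M /= -cats1 count_cat /= addn0; case: b.
(* Respectively: even a final 1 misses the threshold, it is reached without the final bit, or that
   bit decides. *)
have [lt|gt|eq] := ltngtP (count_mem true x).+1 (uphalf n).
- by left; exists false => b; rewrite cnt; case: b; lia.
- by left; exists true => b; rewrite cnt; case: b; lia.
- by right=> b; rewrite cnt -eq; case: b; lia.
Qed.

Lemma majority_distr (n k : nat) (hn : 2 < n) (x : (n - 1).-tuple bool)
    (y : n.-tuple bool) :
  odd n -> uphalf n <= k <= n ->
  M (snoc hn x (M y)) =
  M [tuple if l < k then M (snoc hn x (tnth y l)) else tnth y l | l < n].
Proof.
move=> odd_n k_bounds; have [[c Mxc]|Mxid] := majority_snoc n hn x.
  (* The constant [c] is itself the majority of any tuple with [c] in its first [k] places. *)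
  rewrite Mxc -[LHS](@majority_prefix n k c y) //.
  by congr M; apply: eq_mktuple => l; rewrite Mxc.
rewrite Mxid; congr M; apply: eq_from_tnth => l.
by rewrite tnth_mktuple Mxid if_same.
Qed.

(** Negation turns zeros into ones, and among 2m + 1 entries fewer than m + 1 ones means at least m
    + 1 zeros. *)
Lemma majority_negb (n : nat) (x : n.-tuple bool) :
  odd n -> ~~ M x = M [tuple of map negb x].
Proof.
move=> odd_n; rewrite /M /= count_map.
have -> : count (preim negb (pred1 true)) x = count_mem false x.
  by apply: eq_count => -[].
rewrite count_mem_false size_tuple uphalf_odd //.
have := odd_double_half n; rewrite odd_n -ltnNge.
by move: (count_mem true x) => c; lia.
Qed.

Theorem theorem1 (n : nat) (hodd : odd n) (hn : 3 <= n) :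
  [/\ (* commutativity *)
      forall (x : n.-tuple bool) (i j : 'I_n), i < j ->
        M x = M [tuple tnth x (tperm i j l) | l < n],
      (* majority *)
      (forall (x : n.-tuple bool) (y : bool),
         uphalf n <= count_mem y x -> M x = y) /\
      (forall (x : n.-tuple bool) (i j : 'I_n) (ij : i != j),
         tnth x i != tnth x j -> M x = M (remove2 x ij)),
      (* associativity *)
      forall (z : (n - 2).-tuple bool) (x y w : bool),
        M (snoc2 hn z y (M (snoc2 hn z x w))) =
        M (snoc2 hn z x (M (snoc2 hn z y w))),
      (* distributivity *)
      forall (k : nat) (x : (n - 1).-tuple bool) (y : n.-tuple bool),
        uphalf n <= k <= n - 1 ->
        M (snoc hn x (M y)) =
        M [tuple if l < k then M (snoc hn x (tnth y l)) else tnth y l | l < n]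
    & (* inverter propagation *)
      forall x : n.-tuple bool, ~~ M x = M [tuple of map negb x] ].
Proof.
split.
- by move=> x i j _; rewrite majority_perm.
- split; first by move=> x y; apply: majority_le.
  by move=> x i j ij; apply: majority_remove2; apply: ltnW.
- exact: majority_assoc.
- move=> k x y /andP[le_k le_kn]; apply: majority_distr => //.
  by rewrite le_k (leq_trans le_kn) ?leq_subr.
- by move=> x; apply: majority_negb.
Qed.
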